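(* Let $h$ be any non-negative function on $[0,\infty)$ for which the condition $\lim_{t\to\infty}h(t)=\infty$ fails, and let $Q\subset\mathbb{R}$ be any interval. Then there exists an integrable function $\varphi$ on $Q$ such that $K^d_{h,Q}(\varphi)<\infty$ while $\varphi\notin\mathrm{BMO}^d(Q)$.
   Context: Intervals are bounded with positive length; functions are real-valued. $D(Q)$ is the set of all dyadic subintervals of $Q$ (those obtained from $Q$, including $Q$ itself, by repeated bisection into halves). $\langle\varphi\rangle_J=\frac1{|J|}\int_J\varphi$. For $\varphi\in L^1(Q)$, $$K^d_{h,Q}(\varphi)=\sup_{J\in D(Q)}\langle h(|\varphi-\langle\varphi\rangle_J|)\rangle_J,\qquad \|\varphi\|^2_{\mathrm{BMO}^d(Q)}=\sup_{J\in D(Q)}\big(\langle\varphi^2\rangle_J-\langle\varphi\rangle_J^2\big),$$ and $\mathrm{BMO}^d(Q)=\{\varphi\in L^1(Q)\colon\|\varphi\|_{\mathrm{BMO}^d(Q)}<\infty\}$. *)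

(* Defs.v *)
From HB Require Import structures.
From mathcomp Require Import all_boot all_order all_algebra.
From mathcomp Require Import all_classical all_reals all_analysis.
Set Implicit Arguments.
Unset Strict Implicit.
Unset Printing Implicit Defensive.
Import Order.TTheory GRing.Theory Num.Theory.
Import numFieldNormedType.Exports.
Local Open Scope classical_set_scope.
Local Open Scope ring_scope.

(* Bisection keeps the outer endpoints as they are and gives the midpoint to
   the right half. Where the midpoint goes only changes null sets. *)
Definition left_half (R : realType) (J : interval R) : interval R :=
  let: Interval l _ := J in Interval l (BLeft (miditv J)).

Definition right_half (R : realType) (J : interval R) : interval R :=
  let: Interval _ r := J in Interval (BLeft (miditv J)) r.

Inductive dyadic (R : realType) (Q : interval R) : interval R -> Prop :=
| dyadic_self : dyadic Q Q
| dyadic_left J : dyadic Q J -> dyadic Q (left_half J)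
| dyadic_right J : dyadic Q J -> dyadic Q (right_half J).

(* Extended-real average: for a non-negative f it may be +oo. *)
Definition eaverage (R : realType) (J : interval R) (f : R -> R) : \bar R :=
  (((fine (lebesgue_measure [set` J]))^-1)%:E *
    \int[@lebesgue_measure R]_(x in [set` J]) (f x)%:E)%E.

(* Real average, meaningful when f is integrable on J. *)
Definition average (R : realType) (J : interval R) (f : R -> R) : R :=
  fine (eaverage J f).

Definition oscillation (R : realType) (h phi : R -> R) (J : interval R) :
  R -> R := fun x => h `|phi x - average J phi|.

Definition Kd (R : realType) (h : R -> R) (Q : interval R) (phi : R -> R) :
    \bar R :=
  ereal_sup [set eaverage J (oscillation h phi J) | J in dyadic Q].

(* h is not assumed measurable, so the averages defining Kd make sense only
   when the functions being averaged are measurable. *)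
Definition Kd_defined (R : realType) (h : R -> R) (Q : interval R)
    (phi : R -> R) : Prop :=
  forall J, dyadic Q J -> measurable_fun [set` J] (oscillation h phi J).

Definition L1 (R : realType) (Q : interval R) : set (R -> R) :=
  [set phi | (@lebesgue_measure R).-integrable [set` Q] (EFin \o phi)].

Definition BMOd_norm (R : realType) (Q : interval R) (phi : R -> R) : \bar R :=
  sqrte (ereal_sup
    [set (eaverage J (fun x => phi x ^+ 2)%R - (average J phi ^+ 2)%:E)%E
    | J in dyadic Q]).

Definition BMOd (R : realType) (Q : interval R) : set (R -> R) :=
  [set phi | L1 Q phi /\ (BMOd_norm Q phi < +oo)%E].

(* Main.v *)
(* Choose t_k >= k with h (t_k) bounded. Starting from Q, keep the left half
   repeatedly, and on the n-th right half discarded put +g_n on its own left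
   half and -g_n on its right half, where g_n is 0 or some t_k. Every dyadic
   J is then either a left half that was kept or a discarded right half, on
   which the function has mean 0 by cancellation, or an interval on which it is
   constant. Hence |phi - <phi>_J| takes only the values 0 and t_k, while the
   variance on the n-th right half is g_n^2. Integrability only needs g_n <= n,
   which is achieved by repeating the t_k. *)
Require Import Defs.
From HB Require Import structures.
From mathcomp Require Import all_boot all_order all_algebra.
From mathcomp Require Import all_classical all_reals all_analysis.
From mathcomp Require Import measurable_realfun lra.
Set Implicit Arguments.
Unset Strict Implicit.
Import Order.TTheory GRing.Theory Num.Theory.
Import numFieldNormedType.Exports.
Local Open Scope classical_set_scope.
Local Open Scope ring_scope.

(** * Bisection of intervals, and averages over them *)

Section halves.
Context {R : realType}.
Implicit Types (J Q : interval R) (f : R -> R) (c : R).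

(** Both endpoints are finite, so the length is finite and positive; the open or closed sides stay
    free because bisection changes them. *)
Definition nondegenerate J : Prop :=
  exists s x s' y, J = Interval (BSide s x) (BSide s' y) /\ x < y.

Definition len J : R :=
  fine (lebesgue_measure [set` J]).

Lemma lebesgue_measure_bnd s x s' y : x < y ->
  lebesgue_measure [set` Interval (BSide s x) (BSide s' y)] = (y - x)%:E :> \bar R.
Proof. by move=> xy; rewrite lebesgue_measure_itv /= lte_fin xy. Qed.

Lemma nondegenerate_left J : nondegenerate J -> nondegenerate (left_half J).
Proof.
move=> [s [x [s' [y [-> xy]]]]]; exists s, x, true, ((x + y) / 2); split => //.
lra.
Qed.

Lemma nondegenerate_right J : nondegenerate J -> nondegenerate (right_half J).
Proof.
move=> [s [x [s' [y [-> xy]]]]]; exists true, ((x + y) / 2), s', y; split => //.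
lra.
Qed.

Lemma lebesgue_measure_len J : nondegenerate J ->
  lebesgue_measure [set` J] = (len J)%:E.
Proof.
by move=> [s [x [s' [y [-> xy]]]]]; rewrite /len lebesgue_measure_bnd.
Qed.

Lemma len_gt0 J : nondegenerate J -> 0 < len J.
Proof.
move=> [s [x [s' [y [-> xy]]]]]; rewrite /len lebesgue_measure_bnd//=; lra.
Qed.

Lemma len_left J : nondegenerate J -> len (left_half J) = len J / 2.
Proof.
move=> [s [x [s' [y [-> xy]]]]].
rewrite /len /= !lebesgue_measure_bnd//=; lra.
Qed.

Lemma len_right J : nondegenerate J -> len (right_half J) = len J / 2.
Proof.
move=> [s [x [s' [y [-> xy]]]]].
rewrite /len /= !lebesgue_measure_bnd//=; lra.
Qed.

Lemma halvesU J : nondegenerate J ->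
  [set` J] = [set` left_half J] `|` [set` right_half J].
Proof.
move=> [s [x [s' [y [-> xy]]]]] /=.
by apply: itv_bndbnd_setU; [case: s|case: s']; rewrite bnd_simp; lra.
Qed.

Lemma halves_disj J : nondegenerate J ->
  [disjoint [set` left_half J] & [set` right_half J]].
Proof.
move=> [s [x [s' [y [-> xy]]]]] /=; apply/disj_setPS => z [] /=.
rewrite !itv_boundlr !bnd_simp => /andP[_ zm] /andP[mz _].
by move: (lt_le_trans zm mz); rewrite ltxx.
Qed.

Lemma left_half_sub J : nondegenerate J -> [set` left_half J] `<=` [set` J].
Proof. by move=> /halvesU ->; exact: subsetUl. Qed.

Lemma right_half_sub J : nondegenerate J -> [set` right_half J] `<=` [set` J].
Proof. by move=> /halvesU ->; exact: subsetUr. Qed.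

Lemma nondegenerate_dyadic Q J : nondegenerate Q -> dyadic Q J -> nondegenerate J.
Proof.
move=> ndQ; elim=> // {}J _; first exact: nondegenerate_left.
exact: nondegenerate_right.
Qed.

Lemma integral_cst_len J c : nondegenerate J ->
  (\int[@lebesgue_measure R]_(x in [set` J]) cst c%:E x = (c * len J)%:E)%E.
Proof.
by move=> ndJ; rewrite integral_cst// [X in (_ * X)%E]lebesgue_measure_len.
Qed.

Lemma eaverage_cst J f c : nondegenerate J -> {in [set` J], f =1 cst c} ->
  eaverage J f = c%:E.
Proof.
move=> ndJ fc; rewrite /eaverage (eq_integral (cst c%:E)); last first.
  by move=> x xJ; rewrite fc.
rewrite integral_cst_len// -/(len J) -EFinM mulrCA mulVf ?mulr1//.
by rewrite gt_eqF// len_gt0.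
Qed.

Lemma eaverage_le J f c : nondegenerate J -> measurable_fun [set` J] f ->
  {in [set` J], forall x, 0 <= f x <= c} -> (eaverage J f <= c%:E)%E.
Proof.
move=> ndJ mf f0c; rewrite -(@eaverage_cst J (cst c) c ndJ)// /eaverage.
apply: lee_wpmul2l; first by rewrite lee_fin invr_ge0 fine_ge0.
apply: ge0_le_integral => //.
- by move=> x /mem_set /f0c /andP[]; rewrite lee_fin.
- exact/measurable_EFinP.
- exact: (measurable_cst c%:E).
- by move=> x /mem_set /f0c /andP[_]; rewrite lee_fin.
Qed.

End halves.

(** * The alternating function on the discarded right halves *)

Section alternating.
Context {R : realType}.
Variables (Q : interval R) (g : nat -> R).

Definition stem n : interval R := iter n (@left_half R) Q.

Definition branch n : interval R := right_half (stem n).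

(* Outside all branches [xget] returns a junk index, but then both tests fail. *)
Definition alternating (x : R) : R :=
  let n := xget 0%N [set n | x \in branch n] in
  if x \in left_half (branch n) then g n
  else if x \in right_half (branch n) then - g n else 0.

Hypothesis ndQ : nondegenerate Q.

Lemma nondegenerate_stem n : nondegenerate (stem n).
Proof. by elim: n => //= n; exact: nondegenerate_left. Qed.

Lemma nondegenerate_branch n : nondegenerate (branch n).
Proof. exact/nondegenerate_right/nondegenerate_stem. Qed.

Lemma stem_sub m n : (m <= n)%N -> [set` stem n] `<=` [set` stem m].
Proof.
move=> /subnK <-; elim: (n - m)%N => //= k; apply: subset_trans.
exact/left_half_sub/nondegenerate_stem.
Qed.

Lemma stem_branch_disj m n : (m < n)%N -> [disjoint [set` stem n] & [set` branch m]].
Proof.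
move=> /stem_sub sub; apply/eqP.
by apply: (subsetI_eq0 sub _ (eqP (halves_disj (nondegenerate_stem m)))).
Qed.

Lemma branch_sub m n : (m <= n)%N -> [set` branch n] `<=` [set` stem m].
Proof.
move=> /stem_sub; apply: subset_trans.
exact/right_half_sub/nondegenerate_stem.
Qed.

(** The later of two branches lies in a stem that was cut off from the earlier one. *)
Lemma trivIset_branch : trivIset setT (fun n => [set` branch n]).
Proof.
apply: ltn_trivIset => n m mn; rewrite setIC.
by apply: (subsetI_eq0 _ _ (eqP (stem_branch_disj mn))) => //; exact: branch_sub.
Qed.

Lemma xget_branch n x : x \in branch n -> xget 0%N [set n | x \in branch n] = n.
Proof.
move=> xn; apply: xget_unique => // m xm.
by apply: (@trivIset_branch m n I I); exists x.
Qed.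

Lemma alternating_left n x : x \in left_half (branch n) -> alternating x = g n.
Proof.
move=> xl; rewrite /alternating (@xget_branch n) ?xl//.
exact: (left_half_sub (nondegenerate_branch n)).
Qed.

Lemma alternating_right n x : x \in right_half (branch n) -> alternating x = - g n.
Proof.
move=> xr; rewrite /alternating (@xget_branch n) ?xr; last first.
  exact: (right_half_sub (nondegenerate_branch n)).
case: ifPn => // xl.
by have /disj_setPS/(_ x)[] := halves_disj (nondegenerate_branch n).
Qed.

Lemma alternating_out x : (forall n, x \notin branch n) -> alternating x = 0.
Proof.
move=> xn; rewrite /alternating; set n := xget _ _.
rewrite ifN; last first.
  by apply: contra (xn n); apply: (left_half_sub (nondegenerate_branch n)).
rewrite ifN//.
by apply: contra (xn n); apply: (right_half_sub (nondegenerate_branch n)).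
Qed.

Lemma norm_alternating n x : x \in branch n -> `|alternating x| = `|g n|.
Proof.
move=> xn; have : ([set` left_half (branch n)] `|` [set` right_half (branch n)]) x.
  by rewrite -(halvesU (nondegenerate_branch n)).
by move=> [/alternating_left|/alternating_right] -> //; rewrite normrN.
Qed.

(** [F] may be arbitrary, which is what a non-measurable [h] requires: [alternating] is constant on
    each of countably many measurable pieces. *)
Lemma measurable_comp_alternating (F : R -> R) D :
  measurable D -> measurable_fun D (F \o alternating).
Proof.
move=> mD; apply: (@measurable_funS _ _ _ _ setT) => //.
pose L := \bigcup_n [set` left_half (branch n)].
pose U := \bigcup_n [set` branch n].
have mU : measurable U by exact: bigcup_measurable.
have mL : measurable L by exact: bigcup_measurable.
pose W := \bigcup_n [set` right_half (branch n)].
have mW : measurable W by exact: bigcup_measurable.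
(* On these three sets the values are [g n], [- g n] and 0 respectively. *)
have -> : setT = L `|` (W `|` ~` U).
  apply/esym; rewrite -subTset => x _; have [[n _]|] := pselect (U x); last by right; right.
  rewrite (halvesU (nondegenerate_branch n)) => -[xl|xr]; first by left; exists n.
  by right; left; exists n.
apply/measurable_funU => //; first exact/measurableU/measurableC.
split; last apply/measurable_funU => //.
- apply/measurable_fun_bigcup => // n.
  apply/(@measurable_fun_eqP _ _ _ _ _ _ (cst (F (g n)))) => // x /set_mem xn.
  by rewrite /= (alternating_left xn).
- exact: measurableC.
split.
- apply/measurable_fun_bigcup => // n.
  apply/(@measurable_fun_eqP _ _ _ _ _ _ (cst (F (- g n)))) => // x /set_mem xn.
  by rewrite /= (alternating_right xn).
- apply/(@measurable_fun_eqP _ _ _ _ _ _ (cst (F 0))) => // x /set_mem xn.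
  by rewrite /= alternating_out// => n; apply/negP => xb; apply: xn; exists n.
Qed.

(** Lets an integral over any set be split into a series over the branches. *)
Lemma alternating_restrict :
  (EFin \o alternating) \_ (\bigcup_n [set` branch n]) = EFin \o alternating.
Proof.
apply/funext => x; rewrite patchE; case: ifPn => // /negP xU /=.
rewrite alternating_out// => n; apply/negP => xb; apply: xU.
by apply/mem_set; exists n.
Qed.

(** * Integrability *)

Lemma len_branch n : len (branch n) = len Q / 2 ^+ n.+1.
Proof.
rewrite /branch len_right; last exact: nondegenerate_stem.
rewrite exprSr invfM mulrA; congr (_ / _).
elim: n => [|n IHn]; first by rewrite expr0 divr1.
rewrite /= len_left; last exact: nondegenerate_stem.
by rewrite IHn exprSr invfM mulrA.
Qed.

Lemma sum_halves_lt N : \sum_(0 <= n < N) n%:R / 2 ^+ n.+1 <= 1 :> R.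
Proof.
(* The sum telescopes, since n / 2^(n+1) = (n+1) / 2^n - (n+2) / 2^(n+1). *)
suff -> : \sum_(0 <= n < N) n%:R / 2 ^+ n.+1 = 1 - (N.+1)%:R / 2 ^+ N :> R.
  by rewrite lerBlDr lerDl divr_ge0// exprn_ge0.
elim: N => [|N IHN]; first by rewrite big_nil expr0 divr1 subrr.
rewrite big_nat_recr//= IHN exprSr -[N.+2%:R]natr1 -[N.+1%:R]natr1 invfM.
lra.
Qed.

(** The absolute value is [g n <= n] on a branch of length [len Q / 2 ^+ n.+1], so the integral of
    the absolute value is at most [len Q]. *)
Lemma integrable_alternating D : (forall n, 0 <= g n <= n%:R) -> measurable D ->
  (@lebesgue_measure R).-integrable D (EFin \o alternating).
Proof.
move=> gn mD; apply: (@integrableS _ _ _ _ setT) => //.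
rewrite -alternating_restrict; apply: (integrable_mkcond _ _).1.
  exact: bigcup_measurable.
have mU : measurable_fun (\bigcup_n [set` branch n]) (EFin \o alternating).
  apply/measurable_EFinP; apply: (measurable_comp_alternating id).
  exact: bigcup_measurable.
apply/integrableP; split => //.
rewrite ge0_integral_bigcup//; last 2 first.
- exact: measurableT_comp.
- exact: trivIset_branch.
rewrite (@le_lt_trans _ _ (len Q)%:E)// ?ltry//.
rewrite (eq_eseriesr (g := fun n => (g n * len (branch n))%:E)); last first.
  move=> n _; rewrite (eq_integral (cst (g n)%:E)).
    by rewrite integral_cst_len//; exact: nondegenerate_branch.
  move=> x /set_mem xn; rewrite /= (norm_alternating xn) ger0_norm//.
  by have /andP[] := gn n.
apply: lime_le.
  apply: is_cvg_nneseries => n _ _; rewrite lee_fin mulr_ge0//.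
    by have /andP[] := gn n.
  exact/ltW/len_gt0/nondegenerate_branch.
apply: nearW => N; rewrite sumEFin lee_fin.
apply: (@le_trans _ _ (len Q * \sum_(0 <= n < N) n%:R / 2 ^+ n.+1)).
  rewrite mulr_sumr; apply: ler_sum => n _.
  rewrite len_branch mulrCA ler_wpM2l//; first exact/ltW/len_gt0.
  by rewrite ler_wpM2r ?invr_ge0 ?exprn_ge0//; have /andP[] := gn n.
by rewrite ler_piMr ?sum_halves_lt// ltW// len_gt0.
Qed.

(** * Cancellation of means and the oscillation bound *)

Lemma integral_branch n :
  (\int[@lebesgue_measure R]_(x in [set` branch n]) (alternating x)%:E = 0)%E.
Proof.
have ndB := nondegenerate_branch n.
rewrite (halvesU ndB) integral_setU//; last 2 first.
- apply/measurable_EFinP; apply: (measurable_comp_alternating id).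
  exact: measurableU.
- exact: halves_disj.
rewrite (eq_integral (cst (g n)%:E)); last first.
  by move=> x /set_mem xl; rewrite (alternating_left xl).
rewrite [X in (_ + X)%E](eq_integral (cst (- g n)%:E)); last first.
  by move=> x /set_mem xl; rewrite (alternating_right xl).
rewrite !integral_cst_len; last 2 first.
- exact: nondegenerate_right.
- exact: nondegenerate_left.
by rewrite len_left// len_right// -EFinD mulNr subrr.
Qed.

Lemma average_branch n : average (branch n) alternating = 0.
Proof. by rewrite /average /eaverage integral_branch mule0. Qed.

(** The integral is a series over branches, each contributing 0. The bound on [g] gives the
    integrability that this countable splitting needs. *)
Lemma average_stem n : (forall m, 0 <= g m <= m%:R) ->
  average (stem n) alternating = 0.
Proof.
move=> gm; rewrite /average /eaverage.
suff -> : (\int[@lebesgue_measure R]_(x in [set` stem n]) (alternating x)%:E = 0)%E.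
  by rewrite mule0.
rewrite -/(EFin \o alternating).
have -> : (\int[@lebesgue_measure R]_(x in [set` stem n]) (alternating x)%:E =
    \int[@lebesgue_measure R]_(x in [set` stem n])
      ((EFin \o alternating) \_ (\bigcup_n [set` branch n])) x)%E.
  by rewrite alternating_restrict.
rewrite -integral_mkcondr setI_bigcupr integral_bigcup; last 3 first.
- apply: trivIset_setIl; exact: trivIset_branch.
- by move=> k; exact: measurableI.
- apply: integrable_alternating => //; apply: bigcup_measurable => k _.
  exact: measurableI.
(* Branch [k] lies inside stem [n] if [n <= k] and misses it otherwise. *)
apply: eseries0 => k _ _; have [nk|kn] := leqP n k.
  by rewrite setIidr ?integral_branch//; exact: branch_sub.
by have /eqP -> := stem_branch_disj kn; rewrite integral_set0.
Qed.

(** Induction on bisection: a stem splits into a stem and a branch, a branch into two intervals of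
    constancy, and constancy passes to halves. *)
Lemma dyadic_alternating J : dyadic Q J ->
  [\/ exists n, J = stem n, exists n, J = branch n |
      exists c, {in [set` J], alternating =1 cst c}].
Proof.
elim=> [|{}J dJ IHJ|{}J dJ IHJ]; first by constructor 1; exists 0%N.
  case: IHJ => [[n ->]|[n ->]|[c cJ]].
  - by constructor 1; exists n.+1.
  - by constructor 3; exists (g n) => x /set_mem/alternating_left.
  - constructor 3; exists c => x /set_mem xl; apply/cJ/mem_set.
    exact: (left_half_sub (nondegenerate_dyadic ndQ dJ)).
case: IHJ => [[n ->]|[n ->]|[c cJ]].
- by constructor 2; exists n.
- by constructor 3; exists (- g n) => x /set_mem/alternating_right.
- constructor 3; exists c => x /set_mem xl; apply/cJ/mem_set.
  exact: (right_half_sub (nondegenerate_dyadic ndQ dJ)).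
Qed.

Lemma oscillation_alternating h J x M : (forall m, 0 <= g m <= m%:R) ->
  (forall n, h (g n) <= M) -> h 0 <= M ->
  dyadic Q J -> x \in [set` J] -> oscillation h alternating J x <= M.
Proof.
move=> gm hg h0 dJ xJ; rewrite /oscillation.
(* The mean vanishes on stems and branches, so there the oscillation is [h] of the absolute value
   itself; on an interval of constancy it is [h 0]. *)
have hM y : h `|alternating y| <= M.
  have [[n yn]|yn] := pselect (exists n, y \in branch n).
    by rewrite (norm_alternating yn) ger0_norm//; have /andP[] := gm n.
  by rewrite alternating_out ?normr0// => n; apply/negP => ?; apply: yn; exists n.
have [[n JE]|[n JE]|[c cJ]] := dyadic_alternating dJ.
- by rewrite JE average_stem// subr0.
- by rewrite JE average_branch subr0.
rewrite {1}/average (eaverage_cst (nondegenerate_dyadic ndQ dJ) cJ) cJ//=.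
by rewrite subrr normr0.
Qed.

Lemma Kd_defined_alternating h : Kd_defined h Q alternating.
Proof.
move=> J _.
exact: (measurable_comp_alternating (fun y => h `|y - average J alternating|)).
Qed.

Lemma Kd_alternating h M : (forall t, 0 <= t -> 0 <= h t) ->
  (forall m, 0 <= g m <= m%:R) -> (forall n, h (g n) <= M) -> h 0 <= M ->
  (Kd h Q alternating <= M%:E)%E.
Proof.
move=> h_ge0 gm hg h0; apply: ge_ereal_sup => _ [J dJ <-].
apply: eaverage_le; first exact: nondegenerate_dyadic dJ.
  exact: Kd_defined_alternating.
by move=> x xJ; rewrite h_ge0//= oscillation_alternating.
Qed.

(** * Membership in dyadic BMO forces bounded heights *)

Lemma dyadic_branch n : dyadic Q (branch n).
Proof.
by constructor; elim: n => [|n IHn]; constructor.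
Qed.

(** On branch [n] the mean is 0 and the square is constantly [g n ^+ 2], so this is one of the
    variances in the supremum. *)
Lemma BMOd_alternating : BMOd Q alternating -> exists C, forall n, g n ^+ 2 <= C.
Proof.
move=> [_]; rewrite /BMOd_norm; set S := ereal_sup _ => Slty.
have gS n : ((g n ^+ 2)%:E <= S)%E.
  apply: ereal_sup_ubound; exists (branch n); first exact: dyadic_branch.
  rewrite average_branch expr0n/= sube0; apply: eaverage_cst => [|x /set_mem xn].
    exact: nondegenerate_branch.
  by rewrite /= -[LHS]real_normK ?num_real// (norm_alternating xn) real_normK ?num_real.
(* The supremum is a real number: the finite norm excludes [+oo], and the lower bounds [gS] exclude
   [-oo]. *)
exists (fine S) => n; move: Slty (gS n) (gS 0%N).
by case: S {gS} => //= r _; rewrite lee_fin.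
Qed.

End alternating.

(** * Choice of the heights and conclusion *)

Lemma not_cvg_pinfty (R : realType) (h : R -> R) : ~ (h t @[t --> +oo] --> +oo) ->
  exists A, forall x, exists2 t, x <= t & h t <= A.
Proof.
move=> /cvgryPge/existsNP[A hA]; exists A => x; apply: contrapT => hx; apply: hA.
exists x; split; first exact: num_real.
move=> t xt; rewrite leNgt; apply/negP => /ltW hA; apply: hx.
by exists t => //; exact: ltW.
Qed.

(* Each [t k] is used at all the indices [n = 2 ^ k * (2 * m + 1)], so it appears
   as soon as [n] exceeds it, however sparse the sequence [t] is. *)
Definition slowed (R : realType) (t : nat -> R) (n : nat) : R :=
  if t (logn 2 n) <= n%:R then t (logn 2 n) else 0.

Lemma slowed_bound (R : realType) (t : nat -> R) n : (forall k, 0 <= t k) ->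
  0 <= slowed t n <= n%:R.
Proof. by move=> t0; rewrite /slowed; case: ifPn => [->|_]; rewrite ?t0 ?lexx/=. Qed.

Lemma slowed_surj (R : realType) (t : nat -> R) k : exists n, slowed t n = t k.
Proof.
(* The odd factor keeps the 2-adic valuation equal to [k] and makes [n] at least [m + 1], which
   exceeds [t k]. *)
pose m := Num.truncn (t k); pose n := (2 ^ k * m.*2.+1)%N.
have kE : logn 2 n = k.
  rewrite /n lognM ?expn_gt0// pfactorK// logn_coprime ?addn0//.
  by rewrite coprime2n /= odd_double.
exists n; rewrite /slowed kE ifT// (le_trans (ltW (real_truncnS_gt (num_real _))))//.
rewrite ler_nat (@leq_trans m.*2.+1)//; first by rewrite ltnS -addnn leq_addr.
by rewrite leq_pmull// expn_gt0.
Qed.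

Theorem lemma6p2 (R : realType) (h : R -> R)
    (h_ge0 : forall t : R, 0 <= t -> 0 <= h t)
    (h_lim : ~ (h t @[t --> +oo] --> +oo))
    (a b : R) (ab : a < b) (sa sb : bool) :
  let Q := Interval (BSide sa a) (BSide sb b) in
  exists phi : R -> R,
    [/\ L1 Q phi, Kd_defined h Q phi, (Kd h Q phi < +oo)%E & ~ BMOd Q phi].
Proof.
move=> Q; have ndQ : nondegenerate Q by exists sa, a, sb, b.
have [A hA] := not_cvg_pinfty h_lim.
have /choice[t ht] : forall k : nat, exists t, k%:R <= t /\ h t <= A.
  by move=> k; have [t kt htA] := hA k%:R; exists t.
have g_bnd n : 0 <= slowed t n <= n%:R.
  by apply: slowed_bound => k; apply: le_trans (ht k).1.
exists (alternating Q (slowed t)); split.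
- exact: integrable_alternating.
- exact: Kd_defined_alternating.
(* The bound [A] controls [h] only at the points [t k]; the value 0 of the function brings in
   [h 0]. *)
- apply: le_lt_trans (ltry (Num.max A (h 0))).
  apply: Kd_alternating => // [n|]; last by rewrite le_max lexx orbT.
  rewrite /slowed; case: ifP => _; last by rewrite le_max lexx orbT.
  by rewrite le_max (ht _).2.
- move=> /(BMOd_alternating ndQ)[C gC].
  have C1 : 0 <= C + 1 by rewrite addr_ge0// (le_trans _ (gC 0%N))// sqr_ge0.
  (* This [k] exceeds [C + 1], hence so does [t k]; as [C + 1 >= 0], the square of [t k] then
     exceeds [C]. *)
  pose k := (Num.truncn (C + 1)).+1; have [n gn] := slowed_surj t k.
  have Ct : C + 1 < t k.
    exact: lt_le_trans (real_truncnS_gt (num_real _)) (ht k).1.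
  have := gC n; rewrite gn; nra.
Qed.
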